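(* Let $P(x_1,\dots,x_n)=\sum_{i=1}^{k}a_iM_i(x_1,\dots,x_n)$ be a polynomial with integer coefficients, where $M_1,\dots,M_k$ are the distinct monic monomials of $P$ and $a_1,\dots,a_k$ are their nonzero coefficients. Suppose that $k\ge 3$, that $P$ satisfies Rado's Condition, and that, for every index $i\le k$, in the monomial $M_i$ there are at least $m_i=\max\{1,l_i\}$ exclusive variables with degree equal to $1$. Then $P(x_1,\dots,x_n)$ is injectively partition regular on $\mathbb{N}$.
   Context: $\mathbb{N}=\{1,2,3,\dots\}$. Writing $P(x_1,\dots,x_n)$ means that $x_1,\dots,x_n$ are exactly the variables occurring in $P$; $V(P)=\{x_1,\dots,x_n\}$. All polynomials have constant term equal to zero. For $x\in V(P)$, $d(x)$ denotes the degree of the variable $x$ in $P$, and $d_i(x)$ denotes the degree of $x$ in the monomial $M_i$ (which is $0$ if $x$ does not divide $M_i$). $NL(P)=\{x\in V(P)\mid d(x)\ge 2\}$. For $i\le k$, $l_i=\max\{d(x)-d_i(x)\mid x\in NL(P)\}$ (with $l_i=0$ if $NL(P)=\emptyset$). $P=\sum_{i=1}^k a_iM_i$ satisfies Rado's Condition if there is a nonempty $J\subseteq\{1,\dots,k\}$ with $\sum_{j\in J}a_j=0$. A variable $v$ is exclusive for the monomial $M_i$ in $P$ if $v$ divides $M_i$ and $v$ does not divide $M_j$ for any $j\ne i$. $P(x_1,\dots,x_n)$ is injectively partition regular on $\mathbb{N}$ if for every natural number $r$ and every partition $\mathbb{N}=\bigcup_{i=1}^{r}A_i$ there are an index $j\le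 r$ and mutually distinct $b_1,\dots,b_n\in A_j$ with $P(b_1,\dots,b_n)=0$. *)

(* Defs.v *)
From mathcomp Require Import all_boot all_order all_algebra finmap.
From mathcomp Require Import classical_sets.
From mathcomp Require Import mpoly.

Set Implicit Arguments.
Unset Strict Implicit.
Unset Printing Implicit Defensive.

Local Open Scope ring_scope.

(* For P : {mpoly int[n]}, the distinct monic monomials M_1, ..., M_k of P are  *)
(* the elements of msupp P, a_i is P@_(M_i), and the degree d_i(x) of the       *)
(* variable x in a monomial m is m x.                                           *)

Section Monomials.
Variables (n : nat) (P : {mpoly int[n]}).

Definition pvars : {set 'I_n} :=
  [set x : 'I_n | has (fun m : 'X_{1..n} => 0 < m x)%N (msupp P)].

Definition vdeg (x : 'I_n) : nat := \max_(m <- msupp P) m x.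

Definition nlvars : {set 'I_n} := [set x in pvars | (2 <= vdeg x)%N].

(* The number l_i for m = M_i; an empty \max is 0, as required when NL(P) is    *)
(* empty.                                                                       *)
Definition deg_gap (m : 'X_{1..n}) : nat := \max_(x in nlvars) (vdeg x - m x)%N.

Definition rado_condition : Prop :=
  exists J : {fset 'X_{1..n}},
    [/\ J != fset0, {subset J <= msupp P} & \sum_(m <- J) P@_m = 0].

Definition exclusive (x : 'I_n) (m : 'X_{1..n}) : bool :=
  (0 < m x)%N && all (fun m' : 'X_{1..n} => (m' != m) ==> (m' x == 0)%N) (msupp P).

(* Here N = {1, 2, 3, ...}; [partition] asks the classes to be disjoint and     *)
(* nonempty, so no partition exists for r = 0.                                  *)
Definition injectively_partition_regular : Prop :=
  forall (r : nat) (A : 'I_r -> set nat),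
    partition setT A [set a : nat | (0 < a)%N]%classic ->
    exists (j : 'I_r) (b : 'I_n -> nat),
      [/\ injective b, forall i, A j (b i) & P.@[fun i => (b i)%:Z] = 0].

End Monomials.

(* Main.v *)
Require Import Defs.
From mathcomp Require Import all_boot all_order all_algebra finmap.
From mathcomp Require Import boolp classical_sets.
From mathcomp Require filter.
From mathcomp Require Import mpoly.
From mathcomp Require Import zify ring.
Import -(notations) filter.

Set Implicit Arguments.
Unset Strict Implicit.
Unset Printing Implicit Defensive.

(** Write the polynomial as the sum of the [a_i M_i].  If the variables can be
    given values for which every monomial takes the form [M_i = y_i * C], with
    one factor [C] common to all [i], then [P] vanishes as soon as
    [\sum_i a_i y_i = 0], and the nonlinear problem becomes a linear one with
    multiplicative side conditions.

    Such values exist because of the exclusive variables.  Call the first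
    exclusive linear variable of each monomial its leader, and attach to every
    other variable [v] a number [w_v].  A variable that is not a leader receives
    [w_v], times possibly some other [w]'s; the leader of [M_i] receives [y_i]
    times some [w]'s.  If [v] has degree [d(v)] in [P] and [d_i(v)] in [M_i],
    then [M_i] lacks [d(v) - d_i(v)] factors [w_v]; these are spread, one each,
    over the first [d(v) - d_i(v)] exclusive linear variables of [M_i], and the
    hypothesis on [m_i] says precisely that there are enough of them.  Every
    monomial then evaluates to [y_i] times the product of the [w_v ^ d(v)]
    ([monomial_value]).  All the values used are products [y_o * \prod_F w] with
    [F] a set of variables, and distinct variables use distinct products
    ([code_inj]).

    It remains to find, in one class of the partition, a solution [y] of the
    linear equation and numbers [w] all of whose products [\prod_F w] and
    [y_i * \prod_F w] lie in that class and are distinct ([product_system]).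
    They come from an ultrafilter [U] on the natural numbers that is idempotent
    for multiplication and all of whose members contain a solution of the linear
    equation in distinct positive integers ([solution_ultrafilter]): idempotency
    allows the numbers [w] to be chosen one after another, as in the
    Galvin-Glazer proof of Hindman's theorem.

    Solutions of a homogeneous equation are stable under dilation, so the
    ultrafilters all of whose members contain solutions form a closed left ideal
    for multiplication, and the Ellis-Numakura lemma ([idempotent_ultrafilter])
    produces an idempotent one provided that this ideal is not empty.  Nonemptiness
    is the theorem of Rado for one equation, with distinct entries
    ([distinct_rado]).  It is proved by induction on the number of colours, from
    van der Waerden's theorem and a compactness argument. *)

(** * Idempotent ultrafilters *)

Section IdempotentUltrafilter.
Local Open Scope classical_set_scope.
Variables (T : Type) (op : T -> T -> T).
Hypothesis opA : associative op.

Definition quotient_set (A : set T) (x : T) : set T := [set z | A (op x z)].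

(** On ultrafilters this is the product of the Stone-Cech compactification of the
    semigroup.  A filter [F] stands for the closed set of the ultrafilters that
    contain it, and [F `<=` filter_mul F F] makes that set a subsemigroup. *)
Definition filter_mul (F G : set (set T)) : set (set T) :=
  [set A | F [set x | G (quotient_set A x)]].

Let stable_filter (F : set (set T)) :=
  ProperFilter F /\ F `<=` filter_mul F F.

(** A maximal stable filter is a minimal closed subsemigroup. *)
Lemma maximal_stable_filter (F0 : set (set T)) :
  stable_filter F0 -> exists F, [/\ stable_filter F, F0 `<=` F &
    forall G, stable_filter G -> F `<=` G -> G `<=` F].
Proof.
move=> sF0.
(* The empty family is admitted because it is the union of the empty chain. *)
pose P : set (set (set T)) :=
  [set F | F = set0 \/ (stable_filter F /\ F0 `<=` F)].
have chainP (C : set (set (set T))) :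
    C `<=` P -> total_on C subset -> P (\bigcup_(X in C) X).
  move=> CP Ctot.
  have good X A : C X -> X A -> stable_filter X /\ F0 `<=` X.
    by move=> CX XA; case: (CP X CX) => // X0; rewrite X0 in XA.
  have [[X0 [CX0 [A0 X0A0]]]|C0] := pselect (exists X, C X /\ exists A, X A);
    last first.
    left; apply/seteqP; split=> // A [X CX XA]; apply: C0.
    by exists X; split=> //; exists A.
  have [[pX0 sX0] F0X0] := good _ _ CX0 X0A0.
  right; split; last by move=> A /F0X0 X0A; exists X0.
  split; last first.
    move=> A [X CX XA]; have [[pX sX] _] := good _ _ CX XA.
    exists X => //; have XX : X _ := sX _ XA; apply: (filterS _ XX) => x XAx.
    by exists X.
  split.
    move=> [X CX X00]; have [[pX _] _] := good _ _ CX X00.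
    exact: (@filter_not_empty _ X).
  split.
  - by exists X0 => //; exact: filterT.
  - move=> A B [X CX XA] [Y CY YB].
    have [[pX _] _] := good _ _ CX XA.
    have [[pY _] _] := good _ _ CY YB.
    have [XY|YX] := Ctot _ _ CX CY.
      by exists Y => //; apply: filterI => //; exact: XY.
    by exists X => //; apply: filterI => //; exact: YX.
  - move=> A B AB [X CX XA]; have [[pX _] _] := good _ _ CX XA.
    by exists X => //; exact: filterS XA.
have [F [PF Fmax]] := Zorn_bigcup chainP.
have [sF F0F] : stable_filter F /\ F0 `<=` F.
  case: PF => // F_0; exfalso; apply: (Fmax F0); last by right; split.
  have F0T : F0 setT by have [pF0 _] := sF0; exact: filterT.
  by split; rewrite F_0 => // /(_ _ F0T).
exists F; split=> // G sG FG; apply: contrapT => GF.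
by apply: (Fmax G); [split|right; split=> //; exact: subset_trans FG].
Qed.

(** The Ellis-Numakura argument in terms of filters.  Let [S] be the minimal
    closed subsemigroup given by [F], and let [U] be one of its points.  The
    closed subsemigroup [S * U] of [S] is all of [S] by minimality; hence the
    points [V] of [S] with [V * U = U] form a nonempty closed subsemigroup, which
    is again all of [S] and therefore contains [U]. *)
Lemma idempotent_ultrafilter (F0 : set (set T)) :
  ProperFilter F0 -> F0 `<=` filter_mul F0 F0 ->
  exists U, [/\ UltraFilter U, F0 `<=` U & U `<=` filter_mul U U].
Proof.
move=> pF0 sF0.
have [F [[pF sF] F0F Fmax]] := maximal_stable_filter (conj pF0 sF0).
have [U [uU FU]] := @ultraFilterLemma _ F pF.
have pU : ProperFilter U by exact: ultra_proper.
have fF : Filter F by exact: filter_filter.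
have quotientM A x y : quotient_set (quotient_set A x) y = quotient_set A (op x y).
  by apply/seteqP; split=> z; rewrite /quotient_set /= opA.
(* The filter of [S * U]. *)
have FmulU_sub : filter_mul F U `<=` F.
  apply: Fmax.
    split; first split.
    - move=> F_0; apply: (@filter_not_empty _ F pF).
      have FF : F _ := F_0; apply: (filterS _ FF) => x /=.
      by move=> U0; case: (@filter_not_empty _ U pU).
    - split.
      + by apply: (@filterS _ F _ setT _ _ filterT) => x _; exact: filterT.
      + move=> A B FA FB; have FAB : F _ := @filterI _ F fF _ _ FA FB.
        apply: (@filterS _ F _ _ _ _ FAB) => x [UA UB].
        exact: filterI UA UB.
      + move=> A B AB; apply: (@filterS _ F) => x; apply: filterS => z; exact: AB.
    move=> A FA; have FFA : F _ := sF _ FA.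
    have FD : F [set x | filter_mul F U (quotient_set A x)].
      apply: (@filterS _ F _ _ _ _ FFA) => x; apply: (@filterS _ F) => y.
      by move=> UAxy; rewrite /= quotientM; exact: UAxy.
    by have FFD : F _ := sF _ FD; apply: (@filterS _ F _ _ _ _ FFD) => x /FU.
  move=> A FA; have FFA : F _ := sF _ FA.
  by apply: (@filterS _ F _ _ _ _ FFA) => x /FU.
(* [H] is the filter of the set of the [V] in [S] such that [V * U = U]. *)
pose stab (A : set T) : set T := [set x | U (quotient_set A x)].
pose H : set (set T) :=
  [set D | exists C A, [/\ F C, U A & C `&` stab A `<=` D]].
have stabI A B : stab (A `&` B) = stab A `&` stab B.
  apply/seteqP; split=> x /=.
    by move=> UAB; split; apply: filterS UAB => z [].
  by move=> [UA UB]; exact: filterI UA UB.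
have filterH : filter.Filter H.
  split.
  - by exists setT, setT; split=> //; exact: filterT.
  - move=> D1 D2 [C1 [A1 [F1 U1 s1]]] [C2 [A2 [F2 U2 s2]]].
    exists (C1 `&` C2), (A1 `&` A2); split; [exact: filterI|exact: filterI|].
    by rewrite stabI => x [[c1 c2] [a1 a2]]; split; [exact: s1|exact: s2].
  - move=> D1 D2 D12 [C [A [FC UA s]]]; exists C, A; split=> //.
    exact: subset_trans D12.
have HF : H `<=` F.
  apply: Fmax; last first.
    by move=> C FC; exists C, setT; split=> [//||x []//]; exact: filterT.
  split; first split=> //.
    move=> [C [A [FC UA s]]].
    have : U (~` A).
      apply/FU/FmulU_sub; apply: filterS FC => x Cx /=.
      have [UAx|//] := in_ultra_setVsetC (quotient_set A x) uU.
      by case: (s x).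
    by move=> /(filterI UA); rewrite setICr; exact: filter_not_empty.
  move=> D [C [A [FC UA s]]].
  exists [set x | F (quotient_set C x)], A; split=> //; first exact: sF.
  move=> x [/= FCx UAx]; exists (quotient_set C x), (quotient_set A x).
  split=> // z [Cz Az]; apply: s; split=> //.
  by move: Az; rewrite /stab /= quotientM.
exists U; split=> //; first exact: subset_trans FU.
move=> A UA; apply/FU/HF; exists setT, A; split=> [|//|x []//]; exact: filterT.
Qed.
End IdempotentUltrafilter.

(** * Van der Waerden's theorem *)

Section VanDerWaerden.

(** Colour focusing.  A family of progressions of length [l + 1] is focused when
    all of them would have the same next term [f] and their colours are pairwise
    distinct.  To enlarge a focused family, colour each integer [x] by the colours
    of the window [x, ..., x + N1]; a progression in this window colouring shifts
    the old family, and adding its difference to all the old differences keeps the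
    family focused.  The windows may overlap.  With more progressions than colours,
    one of them extends to its focus.  The uniform bound [N] is what makes the
    window colouring finite. *)
Lemma van_der_waerden (l : nat) (T : finType) :
  exists N, forall c : nat -> T, exists a d,
    [/\ 0 < d, a <= N, d <= N & forall i, i <= l -> c (a + i * d) = c a].
Proof.
elim: l T => [|l IHl] T.
  exists 1 => c; exists 0, 1; split=> // i; rewrite leqn0 => /eqP ->.
  by rewrite mul0n.
pose start f e := f - l.+1 * e.
pose focused (c : nat -> T) (N f : nat) (es : seq nat) :=
  [/\ f <= N, uniq [seq c (start f e) | e <- es] &
    forall e, e \in es -> [/\ 0 < e, l.+1 * e <= f &
      forall i, i <= l -> c (start f e + i * e) = c (start f e)]].
suff focusing s : exists N, forall c : nat -> T,
    (exists a d, [/\ 0 < d, a <= N, d <= N &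
       forall i, i <= l.+1 -> c (a + i * d) = c a]) \/
    exists f es, size es = s /\ focused c N f es.
  have [N HN] := focusing #|T|.+1; exists N => c.
  have [//|[f [es [size_es [_ uniq_es _]]]]] := HN c.
  have := max_card (mem [seq c (start f e) | e <- es]).
  by rewrite (card_uniqP uniq_es) size_map size_es ltnn.
elim: s => [|s [N1 IHs]].
  by exists 0 => c; right; exists 0, [::].
have [N2 HN2] := IHl {ffun 'I_N1.+1 -> T}.
exists (N1 + N2 + l.+1 * N2) => c.
have [a [d [d_gt0 aN2 dN2 blockE]]] :=
  HN2 (fun x => [ffun j : 'I_N1.+1 => c (x + j)]).
have cE i j : i <= l -> j <= N1 -> c (a + i * d + j) = c (a + j).
  move=> il jN1; have /ffunP/(_ (Ordinal (jN1 : j < N1.+1))) := blockE i il.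
  by rewrite !ffunE.
have [[x [e [e_gt0 xN1 eN1 monoE]]]|[f [es [size_es [fN1 uniq_es es_ok]]]]] :=
    IHs (fun x => c (a + x)).
  left; exists (a + x), e; split=> //; try lia.
  by move=> i il; rewrite -addnA monoE.
have startE e i : e \in es -> i <= l ->
    c (start (a + f + l.+1 * d) (e + d) + i * (e + d)) = c (a + start f e).
  move=> /es_ok [e_gt0 lef monoE] il.
  rewrite -(monoE i il) -(cE i) //; last by rewrite /start; nia.
  by congr c; rewrite /start; nia.
have [/mapP [e ees cE0]|new] :=
    boolP (c (a + f) \in [seq c (a + start f e) | e <- es]).
  left; have [e_gt0 lef monoE] := es_ok e ees.
  exists (a + start f e), e; split=> //; try by rewrite /start; nia.
  move=> i; rewrite leq_eqVlt => /predU1P [->|il].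
    by rewrite -cE0; congr c; rewrite /start; lia.
  by rewrite -addnA monoE.
right; exists (a + f + l.+1 * d), (d :: [seq e + d | e <- es]).
split; first by rewrite /= size_map size_es.
have start0 : start (a + f + l.+1 * d) d = a + f by rewrite /start; lia.
have start1 e : e \in es ->
    c (start (a + f + l.+1 * d) (e + d)) = c (a + start f e).
  by move=> ees; rewrite -(startE e 0) // mul0n addn0.
split; first by nia.
  rewrite /= start0 -map_comp.
  have -> : [seq (fun e => c (start (a + f + l.+1 * d) e)) (e + d) | e <- es]
      = [seq c (a + start f e) | e <- es].
    by apply/eq_in_map => e ees; exact: start1.
  by rewrite new.
move=> e; rewrite inE => /predU1P [->|/mapP [{}e ees ->]].
  split=> //; first by lia.
  by move=> i il; rewrite start0 addnAC cE.
have [e_gt0 lef monoE] := es_ok e ees; split; [by lia|by nia|].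
by move=> i il; rewrite startE // start1.
Qed.
End VanDerWaerden.

(** * Limits of colourings *)

Section Limits.
Local Open Scope classical_set_scope.

Lemma ultra_coloring (X : Type) (U : set (set X)) (T : finType) (c : X -> T) :
  UltraFilter U -> exists t, U [set x | c x = t].
Proof.
move=> uU; have pU : ProperFilter U by exact: ultra_proper.
apply: contrapT => noU.
have UC (t : T) : U [set x | c x <> t].
  have [Ut|//] := in_ultra_setVsetC [set x | c x = t] uU.
  by case: noU; exists t.
have /filter_ex [x cx] : U [set x | forall t, c x <> t].
  exact: filter_forall.
exact: (cx (c x)).
Qed.

(** Compactness of the space of colourings: the limit is taken along a free
    ultrafilter, so that it agrees on any finite set with colourings of
    arbitrarily large index. *)
Lemma limit_coloring (T : finType) (c : nat -> nat -> T) :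
  exists c_lim : nat -> T, forall (s : seq nat) L0,
    exists2 L, L0 <= L & {in s, forall x, c L x = c_lim x}.
Proof.
have [U [uU sU]] := ultraFilterLemma eventually_filter.
have pU : ProperFilter U by exact: ultra_proper.
have /choice [c_lim c_limU] x := ultra_coloring (fun L => c L x) uU.
exists c_lim => s L0.
have Us : U [set L | {in s, forall x, c L x = c_lim x}].
  elim: s => [|x s IHs]; first by apply: filterS filterT.
  apply: filterS (filterI (c_limU x) IHs) => L [/= cLx cLs] z.
  by rewrite inE => /predU1P [->|/cLs].
have UL0 : U [set L | L0 <= L] by apply: sU; exists L0.
have /filter_ex [L [cL L0L]] :
  U ([set L | {in s, forall x, c L x = c_lim x}] `&` [set L | L0 <= L]).
  exact: filterI.
by exists L.
Qed.
End Limits.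

(** * Rado's theorem for one equation, with distinct entries *)

Section LinearEquation.
Import GRing.Theory Num.Theory.
Local Open Scope ring_scope.

Lemma ex_nat_nonroot (p : {poly int}) : p != 0 -> exists t : nat, ~~ root p t%:Z.
Proof.
move=> p0; apply: contrapT => allroots.
have := @max_poly_roots _ p [seq i%:Z | i <- iota 0 (size p)] p0.
rewrite size_map size_iota ltnn => H; suff: false by []; apply: H.
  apply/allP => _ /mapP [i _ ->]; apply: contrapT => /negP nroot.
  by apply: allroots; exists i.
by rewrite map_inj_uniq ?iota_uniq // => i j [].
Qed.

Variables (I : finType) (a : I -> int).
Hypothesis a_neq0 : forall i, a i != 0.

Definition distinct_solution (y : I -> nat) :=
  [/\ injective y, forall i, (0 < y i)%N & \sum_i a i * (y i)%:Z = 0].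

Lemma distinct_solutionM s y : (0 < s)%N ->
  distinct_solution y -> distinct_solution (fun i => s * y i)%N.
Proof.
move=> s0 [y_inj y_gt0 sum_y]; split.
- by move=> i j /eqP; rewrite eqn_pmul2l // => /eqP /y_inj.
- by move=> i; rewrite muln_gt0 s0 y_gt0.
- under eq_bigr => i _ do rewrite PoszM mulrCA.
  by rewrite -mulr_sumr sum_y mulr0.
Qed.

(** Choosing each [t i] beyond the earlier ones, and beyond the absolute value of
    the partial sum, makes the entries distinct and the sum nonzero. *)
Lemma growing_choice (E : nat -> Prop) (Q : {set I}) :
  (forall b, exists2 x, (b < x)%N & E x) ->
  exists t : I -> nat, [/\ {in Q &, injective t},
    forall i, i \in Q -> (0 < t i)%N /\ E (t i) &
    Q != finset.set0 -> \sum_(i in Q) a i * (t i)%:Z != 0].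
Proof.
move=> E_unb.
suff [t [tinj tE tsum]] : exists t : I -> nat, [/\ {in enum Q &, injective t},
    forall i, i \in enum Q -> (0 < t i)%N /\ E (t i) &
    enum Q != [::] -> \sum_(i <- enum Q) a i * (t i)%:Z != 0].
  exists t; split=> [i j iQ jQ|i iQ|Q0].
  - by apply: tinj; rewrite mem_enum.
  - by apply: tE; rewrite mem_enum.
  - rewrite -big_enum; apply: tsum; apply: contraNneq Q0 => Q0.
    by apply/eqP/setP => i; rewrite -mem_enum Q0 !inE.
elim: (enum Q) (enum_uniq Q) => [_|j js IH /= /andP [jjs js_uniq]].
  by exists (fun=> 0%N).
have [t [tinj tE _]] := IH js_uniq.
pose sum := \sum_(i <- js) a i * (t i)%:Z.
have [x x_big Ex] := E_unb (`|sum| + \max_(i <- js) t i)%N.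
have lt_x i : i \in js -> (t i < x)%N.
  move=> ijs; apply: leq_ltn_trans x_big.
  by apply: leq_trans (leq_addl _ _); apply: leq_bigmax_seq.
exists (fun i => if i == j then x else t i).
have njs i : i \in js -> (i == j) = false.
  by move=> ijs; apply: contraNF jjs => /eqP <-.
split.
- move=> i i'; rewrite !inE => /predU1P [->|ijs] /predU1P [->|i'js] //.
  + by rewrite eqxx njs // => xE; have := lt_x _ i'js; rewrite xE ltnn.
  + by rewrite eqxx njs // => xE; have := lt_x _ ijs; rewrite xE ltnn.
  + by rewrite !njs // => /tinj; apply.
- move=> i; rewrite inE => /predU1P [->|ijs]; last by rewrite njs //; apply: tE.
  by rewrite eqxx; split=> //; lia.
- move=> _; rewrite big_cons eqxx.
  rewrite (eq_big_seq (fun i => a i * (t i)%:Z)); last first.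
    by move=> i ijs; rewrite njs.
  rewrite -/sum; have := a_neq0 j; nia.
Qed.

Variable J : {set I}.
Hypothesis J_neq0 : J != finset.set0.
Hypothesis sumJ : \sum_(i in J) a i = 0.

(** Solutions of [\sum_(i in J) a i * h i = - K * s] abound: all the entries but
    [h i0] may be multiples of [a i0], and [K = `|a i0|] then makes the value of
    [h i0] an integer.  For distinctness, take the free entries to be [a i0] times
    distinct powers of an indeterminate; the entries are then distinct
    polynomials, hence distinct at some integer.  When [J] has two elements and
    [s = 0] the two entries are forced to be equal, which explains the
    hypothesis.  The lower bound comes from adding a constant to [h], which is
    harmless as the coefficients over [J] sum to zero. *)
Lemma distinct_offsets : exists2 K : nat, (0 < K)%N & forall (s : int) (b : nat),
  s != 0 \/ (2 < #|J|)%N -> exists h : I -> nat,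
    [/\ {in J &, injective h}, forall i, i \in J -> (b < h i)%N &
        \sum_(i in J) a i * (h i)%:Z + K%:Z * s = 0].
Proof.
have [i0 i0J] := set0Pn _ J_neq0.
exists `|a i0|%N; first by rewrite absz_gt0.
move=> s b s_or_J.
pose r (i : I) := (enum_rank i).+1.
have r_inj i j : r i = r j -> i = j by move=> [] /val_inj /enum_rank_inj.
pose p0 : {poly int} := (- (sgz (a i0) * s))%:P -
  \sum_(i in J | i != i0) a i *: 'X^(r i).
pose p (i : I) := if i == i0 then p0 else a i0 *: 'X^(r i).
have p0_coef0 : p0`_0 = - (sgz (a i0) * s).
  rewrite coefB coefC eqxx coef_sum big1 ?subr0 // => i _.
  by rewrite coefZ coefXn mulr0.
have p0_coef j : j \in J -> j != i0 -> p0`_(r j) = - a j.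
  move=> jJ ji0; rewrite coefB coefC /= sub0r coef_sum.
  rewrite (bigD1 j) ?jJ //= big1 ?addr0.
    by rewrite coefZ coefXn eqxx mulr1.
  move=> i /andP [_ ij]; rewrite coefZ coefXn.
  case: eqP => [/r_inj ji|]; last by rewrite mulr0.
  by rewrite ji eqxx in ij.
have p0_neq i : i \in J -> i != i0 -> p0 != a i0 *: 'X^(r i).
  move=> iJ ii0; apply/eqP => p0E.
  have [s0|J3] := s_or_J.
    have : p0`_0 = 0 by rewrite p0E coefZ coefXn mulr0.
    move/eqP; rewrite p0_coef0 oppr_eq0 mulf_eq0 (negPf s0) orbF sgz_eq0.
    by rewrite (negPf (a_neq0 _)).
  have [j] : exists j, j \in J :\: [set i; i0]%SET.
    apply/set0Pn; rewrite -card_gt0 cardsD subn_gt0.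
    apply: leq_ltn_trans J3; apply: leq_trans (subset_leq_card (subsetIr _ _)) _.
    by rewrite cards2; case: (_ == _).
  rewrite !inE negb_or => /andP [/andP [ji ji0] jJ].
  have := p0_coef j jJ ji0; rewrite p0E coefZ coefXn.
  case: eqP => [/r_inj ji'|_]; first by rewrite ji' eqxx in ji.
  by rewrite mulr0 => /esym /eqP; rewrite oppr_eq0 (negPf (a_neq0 _)).
have p_neq i j : i \in J -> j \in J -> i != j -> p i != p j.
  move=> iJ jJ ij; rewrite /p.
  case: (eqVneq i i0) (eqVneq j i0) => [ii0|ii0] [ji0|ji0].
  - by rewrite ii0 ji0 eqxx in ij.
  - exact: p0_neq.
  - by rewrite eq_sym; apply: p0_neq.
  apply/eqP => /(congr1 (fun q : {poly int} => q`_(r i))).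
  rewrite !coefZ !coefXn eqxx mulr1.
  case: eqP => [/r_inj ij'|_]; first by rewrite ij' eqxx in ij.
  by rewrite mulr0 => /eqP; rewrite (negPf (a_neq0 _)).
pose q := \prod_(ij : I * I | [&& ij.1 \in J, ij.2 \in J & ij.1 != ij.2])
  (p ij.1 - p ij.2).
have q_neq0 : q != 0.
  apply/prodf_neq0 => -[i j] /and3P [iJ jJ ij] /=.
  by rewrite subr_eq0; apply: p_neq.
have [t qt] := ex_nat_nonroot q_neq0.
pose v i := (p i).[t%:Z].
have v_inj : {in J &, injective v}.
  move=> i j iJ jJ vij; apply/eqP; apply: contraNT qt => ij.
  rewrite /root /q horner_prod (bigD1 (i, j)) /=; last by rewrite iJ jJ ij.
  by rewrite hornerD hornerN -/(v i) vij subrr mul0r.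
have sum_v : \sum_(i in J) a i * v i + `|a i0|%N%:Z * s = 0.
  rewrite (bigD1 i0) //= {1}/v /p eqxx /p0 hornerD hornerC hornerN horner_sum.
  rewrite [X in _ + X + _](eq_bigr
    (fun i => a i0 * (a i *: 'X^(r i)).[t%:Z])); last first.
    by move=> i /andP [_ ii0]; rewrite /v /p (negPf ii0) !hornerZ; ring.
  by rewrite -mulr_sumr abszEsg; ring.
pose B : nat := (b.+1 + \sum_i `|v i|)%N.
have v_big i : b%:Z < v i + B%:Z.
  have : (`|v i| <= \sum_i `|v i|)%N by rewrite (bigD1 i) //= leq_addr.
  by rewrite /B; lia.
exists (fun i => absz (v i + B%:Z)); split.
- move=> i j iJ jJ vij; apply: v_inj => //.
  by have := v_big i; have := v_big j; lia.
- by move=> i _; have := v_big i; lia.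
- apply: etrans sum_v; congr (_ + _).
  rewrite (eq_bigr (fun i => a i * v i + a i * B%:Z)); last first.
    by move=> i _; rewrite gez0_abs ?mulrDr //; have := v_big i; lia.
  by rewrite big_split /= -mulr_suml sumJ mul0r addr0.
Qed.

(** Let [x L + i * d L], [i <= L], be monochromatic progressions of unbounded
    lengths.  Consider the limit [c_lim] of the colourings [z |-> c (K * d L * z)],
    and let [e] be the limit of the colours of the progressions.  If [c_lim] avoids
    [e] on the multiples of some [s], these use fewer colours, and a solution given
    by induction is carried back to [c].  Otherwise [c_lim] takes the value [e] at
    arbitrarily large numbers; the entries outside [J] are multiples [K * d L * t]
    of such numbers [t], and the entries in [J] are taken in the progression, at
    offsets [h] chosen to compensate for them. *)
Lemma rado_induction (n : nat) (T : finType) (C : {set T}) (c : nat -> T) :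
  (2 < #|I|)%N -> (#|C| <= n)%N -> (forall x, (0 < x)%N -> c x \in C) ->
  exists y, distinct_solution y /\ exists t, forall i, c (y i) = t.
Proof.
move=> I3; have [K K_gt0 offsets] := distinct_offsets.
elim: n C c => [|n IHn] C c.
  rewrite leqn0 cards_eq0 => /eqP C0 /(_ 1%N isT).
  by rewrite C0 inE.
move=> C_le cC.
have /choice [/= xd xdP] L : exists xd : nat * nat,
    [/\ (0 < xd.1)%N, (0 < xd.2)%N &
        forall i, (i <= L)%N -> c (xd.1 + i * xd.2)%N = c xd.1].
  have [N vdW] := van_der_waerden L T.
  have [x [d [d_gt0 _ _ mono]]] := vdW (fun z => c z.+1).
  by exists (x.+1, d); split=> // i iL; rewrite addSn mono.
pose x L := (xd L).1; pose d L := (xd L).2.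
have x_gt0 L : (0 < x L)%N by have [] := xdP L.
have d_gt0 L : (0 < d L)%N by have [] := xdP L.
have mono L i : (i <= L)%N -> c (x L + i * d L)%N = c (x L).
  by have [_ _] := xdP L; apply.
(* The value at 0 records the colour of the progression of length [L]. *)
have [c_lim c_limP] := limit_coloring
  (fun L z => if z == 0%N then c (x L) else c (K * d L * z)%N).
pose e := c_lim 0%N.
have c_limC z : c_lim z \in C.
  have [L _ cL] := c_limP [:: z] 0%N.
  rewrite -cL ?inE //; case: eqP => [_|/eqP z0]; apply: cC => //.
  by rewrite !muln_gt0 K_gt0 d_gt0 lt0n.
have [[s [s_gt0 no_e]]|dense_e] := pselect (exists s, (0 < s)%N /\
    forall z, (0 < z)%N -> c_lim (s * z)%N <> e).
  have [||y [y_sol [t yt]]] := IHn (C :\ e) (fun z => c_lim (s * z)%N).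
  - by have := cardsD1 e C; rewrite c_limC; lia.
  - by move=> z z0; rewrite !inE c_limC andbT; apply/eqP/no_e.
  have [L _ cL] := c_limP [seq s * y i | i <- enum I]%N 0%N.
  exists (fun i => (K * d L * s) * y i)%N; split.
    by apply: distinct_solutionM; rewrite // !muln_gt0 K_gt0 d_gt0.
  exists t => i; rewrite -(yt i) -cL; last by apply: map_f; rewrite mem_enum.
  have [_ y_gt0 _] := y_sol.
  by rewrite gtn_eqF ?muln_gt0 ?s_gt0 ?y_gt0 // !mulnA.
have e_unb b : exists2 z, (b < z)%N & c_lim z = e.
  apply: contrapT => none; apply: dense_e; exists b.+1; split=> // z z0 cz.
  by apply: none; exists (b.+1 * z)%N => //; nia.
have [t [t_inj tE t_sum]] := growing_choice (~: J) e_unb.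
have [|h [h_inj h_big h_sum]] :=
  offsets (\sum_(i in ~: J) a i * (t i)%:Z) (\sum_(i in ~: J) K * t i)%N.
  have [CJ0|/t_sum] := eqVneq (~: J) finset.set0; last by left.
  by right; rewrite -(finset.setCK J) CJ0 finset.setC0 cardsT.
have [L hL cL] := c_limP (0%N :: [seq t i | i <- enum I]) (\sum_(i in J) h i)%N.
have h_t i j : i \in J -> j \notin J -> (K * t j < h i)%N.
  move=> iJ jJ; apply: leq_ltn_trans (h_big i iJ).
  by rewrite (bigD1 j) ?inE //= leq_addr.
have K_t i j : i \in J -> j \notin J -> (K * d L * t j < x L + h i * d L)%N.
  by move=> iJ jJ; have := h_t i j iJ jJ; have := d_gt0 L; nia.
exists (fun i => if i \in J then x L + h i * d L else K * d L * t i)%N.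
split; first split.
- move=> i j; case: ifPn => iJ; case: ifPn => jJ.
  + move/eqP; rewrite eqn_add2l eqn_pmul2r // => /eqP; exact: h_inj.
  + by move=> E; have := K_t i j iJ jJ; rewrite E ltnn.
  + by move=> E; have := K_t j i jJ iJ; rewrite E ltnn.
  + move/eqP; rewrite eqn_pmul2l ?muln_gt0 ?K_gt0 ?d_gt0 // => /eqP.
    by apply: t_inj; rewrite inE.
- move=> i; case: ifPn => iJ; first by rewrite addn_gt0 x_gt0.
  by rewrite !muln_gt0 K_gt0 d_gt0; have [] := tE i; rewrite ?inE.
- rewrite (bigID (mem J)) /=.
  rewrite (eq_bigr (fun i => a i * (x L)%:Z + (d L)%:Z * (a i * (h i)%:Z)));
    last by move=> i iJ; rewrite iJ PoszD PoszM; ring.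
  rewrite big_split /= -mulr_suml sumJ mul0r add0r -mulr_sumr.
  rewrite [X in _ + X = _](eq_bigr (fun i => (d L)%:Z * K%:Z * (a i * (t i)%:Z)));
    last by move=> i iJ; rewrite (negPf iJ) !PoszM; ring.
  rewrite -mulr_sumr -mulrA -mulrDr.
  rewrite [X in _ + _ * X](_ : _ = \sum_(i in ~: J) a i * (t i)%:Z).
    by rewrite h_sum mulr0.
  by apply: eq_bigl => i; rewrite inE.
exists e => i; case: ifPn => iJ.
  rewrite mono; first by rewrite /e -cL ?inE.
  by apply: leq_trans hL; rewrite (bigD1 i) //= leq_addr.
have [|ti_gt0 te] := tE i; first by rewrite inE.
by rewrite -te -cL ?gtn_eqF // inE map_f ?orbT // mem_enum.
Qed.

Theorem distinct_rado (T : finType) (c : nat -> T) : (2 < #|I|)%N ->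
  exists y, distinct_solution y /\ exists t, forall i, c (y i) = t.
Proof.
by move=> I3; apply: (@rado_induction #|T| T [set: T] c) => //; rewrite cardsT.
Qed.
End LinearEquation.

(** * Products of numbers and solutions in one set *)

Section ProductSystems.
Local Open Scope classical_set_scope.

Section SolutionUltrafilter.
Variables (I : finType) (a : I -> int) (J : {set I}).
Hypotheses (a_neq0 : forall i, a i != 0%R) (I3 : 2 < #|I|).
Hypotheses (J_neq0 : J != finset.set0) (sumJ : (\sum_(i in J) a i)%R = 0%R).

(** The complements of the sets that are not partition regular for the equation.
    An ultrafilter contains this family if and only if all its members contain
    solutions. *)
Let unavoidable : set (set nat) :=
  [set A | exists (T : finType) (c : nat -> T), forall y,
     distinct_solution a y -> (exists t, forall i, c (y i) = t) ->
     exists i, A (y i)].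

(** Dilation invariance of the equation makes the family [unavoidable] stable;
    that it is a proper filter amounts to Rado's theorem. *)
Lemma solution_ultrafilter : exists U : set (set nat),
  [/\ UltraFilter U, U `<=` filter_mul muln U U,
      forall b, U [set x | b < x] &
      forall A, U A -> exists2 y, distinct_solution a y & forall i, A (y i)].
Proof.
have [i0 i0J] := set0Pn _ J_neq0.
have unavoidable_filter : ProperFilter unavoidable.
  split.
    move=> [T [c cP]].
    have [y [y_sol y_mono]] := distinct_rado a_neq0 J_neq0 sumJ c I3.
    by have [] := cP y y_sol y_mono.
  split.
  - by exists unit, (fun=> tt) => y _ _; exists i0.
  (* The third component makes a monochromatic solution lie entirely inside or
     entirely outside [A]. *)
  - move=> A B [T1 [c1 c1P]] [T2 [c2 c2P]].
    exists (T1 * T2 * bool)%type, (fun x => (c1 x, c2 x, `[< A x >])) => y y_sol.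
    move=> [[[t1 t2] s] mono].
    have [|i Ai] := c1P y y_sol; first by exists t1 => i; case: (mono i).
    have [|j Bj] := c2P y y_sol; first by exists t2 => j; case: (mono j).
    exists j; split=> //; apply/asboolP.
    have [_ _ ->] := mono j; have [_ _ <-] := mono i; exact/asboolP.
  - move=> A B AB [T [c cP]]; exists T, c => y y_sol y_mono.
    by have [i Ai] := cP y y_sol y_mono; exists i; apply: AB.
have unavoidable_stable : unavoidable `<=` filter_mul muln unavoidable unavoidable.
  move=> A [T [c cP]].
  exists unit, (fun=> tt) => y [_ y_gt0 _] _; exists i0.
  exists T, (fun z => c (y i0 * z)) => z z_sol z_mono.
  exact: (cP (fun i => y i0 * z i) (distinct_solutionM (y_gt0 i0) z_sol) z_mono).
have [U [uU FU U_idem]] :=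
  idempotent_ultrafilter mulnA unavoidable_filter unavoidable_stable.
have pU : ProperFilter U by exact: ultra_proper.
exists U; split=> // [b|A UA].
  (* Capping at [b] separates the numbers up to [b]. *)
  apply: FU; exists 'I_b.+1, (fun x => inord (minn x b)) => y [y_inj _ _].
  move=> [t mono]; apply: contrapT => small.
  have yE i : y i = t.
    have yb : y i <= b.
      by rewrite leqNgt; apply/negP => yb; apply: small; exists i.
    by rewrite -(mono i) inordK (minn_idPl yb).
  have : #|I| <= 1.
    by apply/card_le1_eqP => i j _ _; apply: y_inj; rewrite !yE.
  by move: I3; lia.
apply: contrapT => noy; have UAC : U (~` A).
  apply: FU; exists unit, (fun=> tt) => y y_sol _.
  apply: contrapT => yA; apply: noy; exists y => // i.
  by apply: contrapT => yAi; apply: yA; exists i.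
have U0 : U (A `&` ~` A) by exact: filterI.
by rewrite setICr in U0; exact: (@filter_not_empty _ U _).
Qed.
End SolutionUltrafilter.

Definition partial_product (K V : finType) (y : K -> nat) (w : V -> nat)
    (p : option K * {set V}) : nat := oapp y 1 p.1 * \prod_(v in p.2) w v.

(** The Galvin-Glazer construction.  The set [star] of the [x] in [B] such that
    [B / x] belongs to [U] has the property that [star / x] belongs to [U] for
    every [x] in it; so once finitely many products lie in [star], almost every
    [m], with respect to [U], keeps all their multiples by [m] in [star].  The
    solution [y] is chosen first, since the numbers [w] must exceed all the
    products formed before them: this is what makes the products distinct. *)
Lemma product_system (U : set (set nat)) (K V : finType)
    (P : (K -> nat) -> Prop) (A : set nat) :
    UltraFilter U -> U `<=` filter_mul muln U U ->
    (forall b, U [set x | b < x]) ->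
    (forall B, U B -> exists2 y, P y & forall i, B (y i)) ->
    (forall y, P y -> injective y) -> U A ->
  exists (y : K -> nat) (w : V -> nat), [/\ P y,
    forall p : option K * {set V}, p != (None, finset.set0) ->
      A (partial_product y w p) &
    injective (partial_product y w)].
Proof.
move=> uU U_idem U_big U_P P_inj UA.
have pU : ProperFilter U by exact: ultra_proper.
pose B := A `&` [set x | 0 < x].
have UB : U B by exact: filterI.
pose star := [set x | B x /\ U (quotient_set muln B x)].
have U_star : U star by apply: filterI => //; exact: U_idem.
have star_quotient x : star x -> U (quotient_set muln star x).
  move=> [Bx UBx].
  have UBx' : U [set z | U (quotient_set muln (quotient_set muln B x) z)].
    exact: U_idem.
  have UI : U (quotient_set muln B x `&`
      [set z | U (quotient_set muln (quotient_set muln B x) z)]).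
    exact: filterI.
  apply: filterS UI => z [Bxz UBxz]; split=> //.
  by apply: filterS UBxz => u; rewrite /quotient_set /= mulnA.
(* Entries equal to 1 would spoil the injectivity of the products. *)
have [y Py y_star] : exists2 y, P y & forall i, (star `&` [set x | 1 < x]) (y i).
  by apply: U_P; exact: filterI.
have y_gt1 i : 1 < y i by have [] := y_star i.
suff [w [w_star w_inj]] : exists w : V -> nat,
    (forall p : option K * {set V},
       p.2 \subset [set v in enum V]%SET -> p != (None, finset.set0) ->
       star (partial_product y w p)) /\
    {in [pred p : option K * {set V} | p.2 \subset [set v in enum V]%SET] &,
       injective (partial_product y w)}.
  have full (F : {set V}) : F \subset [set v in enum V]%SET.
    by apply/fintype.subsetP => v _; rewrite inE mem_enum.
  exists y, w; split=> // [p p0|p q]; first by have [[]] := w_star p (full _) p0.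
  by apply: w_inj; rewrite inE full.
elim: (enum V) (enum_uniq V) => [_|v vs IHvs /= /andP [v_vs /IHvs]].
  have nil0 (F : {set V}) : F \subset [set v in [::]]%SET -> F = finset.set0.
    move=> /fintype.subsetP F0; apply/setP => v; rewrite inE.
    by apply/negP => /F0; rewrite !inE.
  exists (fun=> 0); split.
    move=> [[i|] F] /= /nil0 ->; last by rewrite eqxx.
    by move=> _; rewrite /partial_product /= big_set0 muln1; have [] := y_star i.
  move=> [o F] [o' F']; rewrite !inE /= => /nil0 -> /nil0 ->.
  rewrite /partial_product /= !big_set0 !muln1.
  case: o o' => [i|] [i'|] //= E; first by rewrite (P_inj y Py i i').
    by have := y_gt1 i; rewrite E.
  by have := y_gt1 i'; rewrite -E.
move=> [w [w_star w_inj]].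
pose old (p : option K * {set V}) := p.2 \subset [set v in vs]%SET.
pose prod_w := partial_product y w.
have U_mult : U [set m | forall p, old p && (p != (None, finset.set0)) ->
    star (prod_w p * m)].
  apply: filter_forall => p.
  have [/andP [old_p p0]|] := boolP (old p && (p != (None, finset.set0))).
    have Up := star_quotient _ (w_star p old_p p0).
    by apply: filterS Up => m Upm _; exact: Upm.
  by move=> np; apply: (@filterS _ U _ setT) => //; exact: filterT.
have [m [[m_star m_mult] m_big]] : exists m,
    (star `&` [set m | forall p, old p && (p != (None, finset.set0)) ->
       star (prod_w p * m)] `&` [set m | \sum_p prod_w p < m]) m.
  apply: (@filter_ex _ U); apply: filterI => //; exact: filterI.
have {}m_big p : prod_w p < m.
  by apply: leq_ltn_trans m_big; rewrite (bigD1 p) //= leq_addr.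
pose w' u := if u == v then m else w u.
have prod_w'1 o (F : {set V}) : v \in F ->
    partial_product y w' (o, F) = prod_w (o, F :\ v) * m.
  move=> vF; rewrite /prod_w /partial_product /= (big_setD1 v vF) /= {1}/w' eqxx.
  rewrite mulnCA mulnC; congr (_ * _ * _); apply: eq_bigr => u.
  by rewrite !inE /w' => /andP [/negPf ->].
have prod_w'0 o (F : {set V}) : v \notin F ->
    partial_product y w' (o, F) = prod_w (o, F).
  move=> vF; rewrite /prod_w /partial_product /=.
  congr (_ * _); apply: eq_bigr => u uF; rewrite /w'.
  by case: eqP uF => // ->; rewrite (negPf vF).
have old0 o (F : {set V}) :
    F \subset [set u in v :: vs]%SET -> v \notin F -> old (o, F).
  move=> /fintype.subsetP sF vF; apply/fintype.subsetP => u uF /=.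
  have := sF u uF; rewrite !inE => /predU1P [uv|//].
  by rewrite -uv uF in vF.
have old1 o (F : {set V}) : F \subset [set u in v :: vs]%SET -> old (o, F :\ v).
  move=> /fintype.subsetP sF; apply/fintype.subsetP => u /=; rewrite !inE.
  by move=> /andP [uv /sF]; rewrite !inE (negPf uv).
have prod_w_gt0 p : old p -> 0 < prod_w p.
  have [->|p0] := eqVneq p (None, finset.set0).
    by rewrite /prod_w /partial_product /= big_set0.
  by move=> old_p; have [[]] := w_star p old_p p0.
exists w'; split.
  move=> [o F] /= sF p0; have [vF|vF] := boolP (v \in F); last first.
    by rewrite prod_w'0 //; apply: w_star => //; exact: old0.
  rewrite prod_w'1 //; have [E|ne] := eqVneq (o, F :\ v) (None, finset.set0).
    by case: E => -> ->; rewrite /prod_w /partial_product /= big_set0 !mul1n.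
  by apply: m_mult; rewrite ne old1.
move=> [o F] [o' F'] /=; rewrite !inE /= => sF sF'.
have [vF|vF] := boolP (v \in F); have [vF'|vF'] := boolP (v \in F').
- rewrite !prod_w'1 // => /eqP; rewrite eqn_pmul2r; last first.
    by have := m_big (None, finset.set0); lia.
  move=> /eqP /w_inj; rewrite !inE => /(_ (old1 _ _ sF) (old1 _ _ sF')) [-> FF'].
  by rewrite -(finset.setD1K vF) FF' finset.setD1K.
- rewrite prod_w'1 // prod_w'0 // => E.
  by have := m_big (o', F'); have := prod_w_gt0 _ (old1 o _ sF); nia.
- rewrite prod_w'0 // prod_w'1 // => E.
  by have := m_big (o, F); have := prod_w_gt0 _ (old1 o' _ sF'); nia.
- by rewrite !prod_w'0 //; apply: w_inj; exact: old0.
Qed.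
End ProductSystems.

(** * The substitution *)

Section Substitution.

Lemma sum_index_lt (T : finType) (A : {set T}) (t : nat) : t <= #|A| ->
  \sum_(x in A) (index x (enum A) < t) = t.
Proof.
rewrite cardE => tA.
rewrite (eq_bigr (fun x => nat_of_bool (x \in take t (enum A)))); last first.
  by move=> x xA; rewrite in_take ?mem_enum.
rewrite -big_mkcondr /= sum1_card -[RHS](size_takel tA).
rewrite -(card_uniqP (take_uniq t (enum_uniq A))); apply: eq_card => x.
rewrite unfold_in /=; case: (boolP (x \in take t (enum A))) => [/mem_take|_].
  by rewrite mem_enum => ->.
by rewrite andbF.
Qed.

Variables (n : nat) (P : {mpoly int[n]}).
Hypothesis P_vars : pvars P = [set: 'I_n].
Hypothesis P_excl : forall m : 'X_{1..n}, m \in msupp P ->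
  maxn 1 (deg_gap P m) <= #|[set x : 'I_n | exclusive P x m & m x == 1]|.

Notation I := 'I_(size (msupp P)).
Definition mon (i : I) : 'X_{1..n} := nth 0%MM (msupp P) i.
Definition excl (i : I) : {set 'I_n} :=
  [set x | exclusive P x (mon i) & mon i x == 1].
Definition rank (i : I) (x : 'I_n) : nat := index x (enum (excl i)).
Definition leader (x : 'I_n) : bool :=
  [exists i, (x \in excl i) && (rank i x == 0)].
Definition owner (x : 'I_n) : option I := [pick i | x \in excl i].
(** The number of factors [w_v] that the [i]-th monomial lacks. *)
Definition missing (i : I) (v : 'I_n) : nat := vdeg P v - mon i v.

(** The variable of rank [j] in the [i]-th monomial supplies a factor [w_v] for
    each [v] of which this monomial lacks more than [j] factors.  This rule also
    covers [v] an exclusive linear variable of another monomial: one factor is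
    missing, and the leader supplies it. *)
Definition factors (x : 'I_n) : {set 'I_n} :=
  [set v | ~~ leader v &
    (v == x) || (if owner x is Some i then rank i x < missing i v else false)].
(** A pair [(o, F)] stands for the product of [y_o], if any, and of the [w_v] for
    [v] in [F]. *)
Definition code (x : 'I_n) : option I * {set 'I_n} :=
  (if leader x then owner x else None, factors x).

Lemma mon_supp i : mon i \in msupp P.
Proof. exact: mem_nth. Qed.

Lemma mon_inj : injective mon.
Proof.
move=> i j /eqP; rewrite nth_uniq ?msupp_uniq // => /eqP ij; exact: val_inj.
Qed.

Lemma excl_mon i x : x \in excl i -> mon i x = 1.
Proof. by rewrite inE => /andP [_ /eqP]. Qed.

Lemma excl_mon0 i j x : x \in excl i -> j != i -> mon j x = 0.
Proof.
rewrite inE => /andP [/andP [_ /allP /(_ _ (mon_supp j)) /implyP H] _] ji.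
by apply/eqP/H; rewrite (inj_eq mon_inj).
Qed.

Lemma excl_owner i x : x \in excl i -> owner x = Some i.
Proof.
move=> xi; rewrite /owner; case: pickP => [j xj|/(_ i)]; last by rewrite xi.
congr Some; apply/eqP; apply: contraT => ji.
by have := excl_mon0 xi ji; rewrite (excl_mon xj).
Qed.

Lemma owner_excl i x : owner x = Some i -> x \in excl i.
Proof. by rewrite /owner; case: pickP => // j xj [<-]. Qed.

Lemma mon_le_vdeg i v : mon i v <= vdeg P v.
Proof.
by apply: (leq_bigmax_seq (F := fun m : 'X_{1..n} => m v)); [exact: mon_supp|].
Qed.

Lemma excl_vdeg i x : x \in excl i -> vdeg P x = 1.
Proof.
move=> xi; apply/eqP; rewrite eqn_leq; apply/andP; split; last first.
  by rewrite -(excl_mon xi) mon_le_vdeg.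
apply/bigmax_leqP_seq => m mP _.
have im : index m (msupp P) < size (msupp P) by rewrite index_mem.
have <- : mon (Ordinal im) = m by rewrite /mon nth_index.
have [->|ji] := eqVneq (Ordinal im) i; first by rewrite excl_mon.
by rewrite (excl_mon0 xi ji).
Qed.

(** The place where the number of exclusive variables is matched against the
    gaps.  Those of nonlinear variables are bounded by [deg_gap]; a variable of
    degree 1 has a gap of at most 1. *)
Lemma missing_le i v : missing i v <= #|excl i|.
Proof.
apply: leq_trans (P_excl (mon_supp i)).
have [v_nl|v_lin] := boolP (v \in nlvars P).
  apply: leq_trans (leq_maxr _ _).
  exact: (leq_bigmax_cond (F := fun x => vdeg P x - mon i x)).
apply: leq_trans (leq_maxl _ _); move: v_lin.
rewrite inE P_vars inE /= -ltnNge /missing; lia.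
Qed.

Lemma leaderP x : leader x -> exists2 i, x \in excl i & rank i x = 0.
Proof. by case/existsP => i /andP [xi /eqP ri]; exists i. Qed.

Lemma rank_inj i x y : x \in excl i -> y \in excl i -> rank i x = rank i y -> x = y.
Proof.
move=> xi yi rxy; rewrite -(nth_index x (s := enum (excl i)) (x := x)) ?mem_enum //.
by rewrite -/(rank i x) rxy nth_index ?mem_enum.
Qed.

Lemma mem_factors_nonleader x : ~~ leader x -> x \in factors x.
Proof. by move=> xl; rewrite inE xl eqxx. Qed.

Lemma code_neq0 x : code x != (None, finset.set0).
Proof.
rewrite /code; case: ifPn => [/leaderP [i xi _]|xl].
  by rewrite (excl_owner xi).
apply/eqP => -[F0]; have := mem_factors_nonleader xl.
by rewrite F0 inE.
Qed.

(** A variable of positive rank supplies only factors of which at least two are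
    missing, and these belong to variables of degree at least 2, which are not
    exclusive linear variables. *)
Lemma factors_nonleader x y :
  ~~ leader x -> ~~ leader y -> x \in factors y -> x != y ->
  owner x = None /\ owner y != None.
Proof.
move=> xl yl; rewrite inE xl /= => /orP [->//|].
case yj: (owner y) => [j|//] lt_missing xy; split=> //.
have yjE := owner_excl yj.
have ry : 0 < rank j y.
  rewrite lt0n; apply: contraNneq yl => ry; apply/existsP; exists j.
  by rewrite yjE ry eqxx.
case xi: (owner x) => [i|//]; have := excl_vdeg (owner_excl xi).
by move: lt_missing; rewrite /missing; lia.
Qed.

(** Leaders are told apart by their monomials.  If two other variables had equal
    codes, each would be a factor of the other, which the degrees forbid. *)
Lemma code_inj : injective code.
Proof.
move=> x y [oE FE].
have leader_eq : leader x = leader y.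
  move: oE; case: ifPn => [/leaderP [i xi _]|_]; case: ifPn => //.
    by rewrite (excl_owner xi).
  by move=> /leaderP [i yi _]; rewrite (excl_owner yi).
move: oE; rewrite -leader_eq; case: ifPn => [xl|xl _].
  have [i xi rx] := leaderP xl.
  have [j yj ry] : exists2 j, y \in excl j & rank j y = 0.
    by apply: leaderP; rewrite -leader_eq.
  rewrite (excl_owner xi) (excl_owner yj) => -[ij].
  by subst j; apply: (rank_inj xi yj); rewrite rx ry.
have yl : ~~ leader y by rewrite -leader_eq.
apply/eqP; apply: contraT => xy.
have [xo yo] : owner x = None /\ owner y != None.
  by apply: factors_nonleader; rewrite // -FE mem_factors_nonleader.
have [yo' _] : owner y = None /\ owner x != None.
  by apply: factors_nonleader; rewrite 1?eq_sym // FE mem_factors_nonleader.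
by rewrite yo' in yo.
Qed.

(** The exponent of [w_v] in the value of a monomial does not depend on the
    monomial: [v] contributes [mon i v], and the exclusive linear variables of rank
    less than [missing i v] contribute the rest. *)
Lemma sum_factors i v : ~~ leader v ->
  \sum_x mon i x * (v \in factors x) = vdeg P v.
Proof.
move=> vl.
rewrite (eq_bigr (fun x => mon i x * (v == x) +
    (if x \in excl i then (rank i x < missing i v : nat) else 0))); last first.
  move=> x _; rewrite inE vl /=; case: ifPn => xi.
    rewrite (excl_owner xi) (excl_mon xi) !mul1n.
    have [->|_] := eqVneq v x; last by [].
    by rewrite /missing (excl_mon xi) (excl_vdeg xi) ltn0.
  case xo: (owner x) => [j|]; last by rewrite orbF addn0.
  have xj := owner_excl xo; rewrite (excl_mon0 xj) //.
  by apply: contraNneq xi => ->.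
rewrite big_split /= -big_mkcond /= sum_index_lt ?missing_le //.
rewrite (bigD1 v) //= eqxx muln1 big1 ?addn0; last first.
  by move=> x /negPf xv; rewrite eq_sym xv muln0.
by rewrite subnKC // mon_le_vdeg.
Qed.

Lemma ex_leader i : exists2 x, x \in excl i & rank i x = 0.
Proof.
have := P_excl (mon_supp i); rewrite -/(excl i) => E_ge1.
have : 0 < size (enum (excl i)).
  by rewrite -cardE; apply: leq_trans E_ge1; exact: leq_maxl.
case enumE: (enum (excl i)) => [//|x s] _; exists x.
  by rewrite -mem_enum enumE mem_head.
by rewrite /rank enumE /= eqxx.
Qed.

Lemma monomial_value (y : I -> nat) (w : 'I_n -> nat) i :
  \prod_x partial_product y w (code x) ^ mon i x =
  y i * \prod_(v | ~~ leader v) w v ^ vdeg P v.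
Proof.
under eq_bigr => x _ do rewrite expnMn.
rewrite big_split /=; congr (_ * _).
  have [x0 x0i rx0] := ex_leader i.
  have x0l : leader x0 by apply/existsP; exists i; rewrite x0i rx0 eqxx.
  rewrite (bigD1 x0) //= x0l (excl_owner x0i) (excl_mon x0i) expn1 big1 ?muln1 //.
  move=> x xx0; case: ifPn => [xl|_]; last by rewrite exp1n.
  have [j xj rx] := leaderP xl; rewrite (excl_owner xj) /=.
  have [ij|ij] := eqVneq i j; last by rewrite (excl_mon0 xj).
  by rewrite -ij in xj rx; rewrite (rank_inj xj x0i) ?rx ?eqxx // in xx0.
rewrite (eq_bigr (fun x => \prod_(v | ~~ leader v)
    w v ^ (mon i x * (v \in factors x)))); last first.
  move=> x _ /=; rewrite (big_morph (expn^~ (mon i x))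
    (fun p q => expnMn p q (mon i x)) (exp1n (mon i x))).
  rewrite [RHS]big_mkcond [LHS]big_mkcond; apply: eq_bigr => v _.
  rewrite inE; case: (leader v) => //=.
  by case: (_ || _); rewrite ?muln1 // muln0.
rewrite exchange_big /=; apply: eq_bigr => v vl.
by rewrite -expn_sum sum_factors.
Qed.
End Substitution.

Lemma meval_natE n (P : {mpoly int[n]}) (b : 'I_n -> nat) :
  (P.@[fun x => (b x)%:Z] =
   \sum_(i < size (msupp P)) P@_(mon i) * (\prod_x b x ^ mon i x)%N%:Z)%R.
Proof.
rewrite mevalE (big_nth 0%MM) big_mkord; apply: eq_bigr => i _; congr (_ * _)%R.
rewrite -[LHS]/(\prod_x _)%R (big_morph Posz PoszM (erefl 1%:Z%R)).
by apply: eq_bigr => x _; rewrite -!natz GRing.natrX.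
Qed.

Lemma rado_index_set n (P : {mpoly int[n]}) : rado_condition P ->
  exists2 J : {set 'I_(size (msupp P))}, J != finset.set0 &
    (\sum_(i in J) P@_(mon i))%R = 0%R.
Proof.
move=> [S [S0 SP sumS]].
have sum_J : (\sum_(i in [set i : 'I_(size (msupp P)) | mon i \in S]%SET)
    P@_(mon i))%R = 0%R.
  rewrite -[RHS]sumS (eq_bigl (fun i => mon i \in S)); last first.
    by move=> i; rewrite inE.
  rewrite -(big_mkord (fun i => nth 0%MM (msupp P) i \in S)
    (fun i => (P@_(nth 0%MM (msupp P) i))%R)).
  rewrite -(big_nth 0%MM (fun m => m \in S) (fun m => (P@_m)%R)) -big_filter.
  apply/perm_big/uniq_perm; rewrite ?filter_uniq ?msupp_uniq ?fset_uniq //.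
  move=> m; rewrite mem_filter; case: (boolP (m \in S)) => // mS.
  by rewrite (SP m mS).
exists [set i : 'I_(size (msupp P)) | mon i \in S]%SET => //.
have [m mS] := fset0Pn _ S0.
have im : index m (msupp P) < size (msupp P) by rewrite index_mem SP.
by apply/set0Pn; exists (Ordinal im); rewrite inE /mon nth_index ?SP.
Qed.

Import GRing.Theory.
Local Open Scope ring_scope.

Theorem theorem4p2 (n : nat) (P : {mpoly int[n]})
    (P_vars : pvars P = [set: 'I_n])
    (P_const : P@_0%MM = 0)
    (P_card : (3 <= size (msupp P))%N)
    (P_rado : rado_condition P)
    (P_excl : forall m : 'X_{1..n}, m \in msupp P ->
       (maxn 1 (deg_gap P m) <=
          #|[set x : 'I_n | exclusive P x m & m x == 1%N]|)%N) :
  injectively_partition_regular P.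
Proof.
move=> r A [coverA _ _].
pose a (i : 'I_(size (msupp P))) : int := P@_(mon i).
have a_neq0 i : a i != 0 by rewrite -mcoeff_msupp mon_supp.
have [J J_neq0 sumJ] := rado_index_set P_rado.
have I3 : (2 < #|'I_(size (msupp P))|)%N by rewrite card_ord.
have [U [uU U_idem U_big U_sol]] := solution_ultrafilter a_neq0 I3 J_neq0 sumJ.
have pU : ProperFilter U by exact: ultra_proper.
have [j UAj] : exists j, U (A j).
  apply: contrapT => noj.
  have UC : U [set x | forall j, ~ A j x]%classic.
    apply: filter_forall => j; have [UAj|//] := in_ultra_setVsetC (A j) uU.
    by case: noj; exists j.
  have UI : U ([set x | forall j, ~ A j x] `&` [set x | 0 < x]%N)%classic.
    exact: filterI.
  have [x [Ax x_gt0]] := filter_ex UI.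
  have : cover setT A x by rewrite coverA.
  by move=> [i _ /Ax].
have [y [w [y_sol A_prod prod_inj]]] :=
  @product_system U _ 'I_n (distinct_solution a) (A j) uU U_idem U_big U_sol
    (fun y y_sol => let: And3 y_inj _ _ := y_sol in y_inj) UAj.
exists j, (fun x => partial_product y w (code P x)); split.
- by move=> x x' /prod_inj /code_inj.
- by move=> x; apply: A_prod; exact: code_neq0.
rewrite meval_natE; have [_ _ sum_y] := y_sol.
rewrite (eq_bigr (fun i => a i * (y i)%:Z *
    (\prod_(v | ~~ leader P v) w v ^ vdeg P v)%N%:Z)).
  by rewrite -mulr_suml sum_y mul0r.
by move=> i _; rewrite monomial_value // PoszM mulrA.
Qed.
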